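(* Let $A$ be a non-empty subset of a finite abelian group $G$ of density $\alpha=|A|/|G|$. If $|A-A|=K|A|$, then $$\eta\ge\left(\frac{1+\sqrt5}{2}\right)^{1/2}\frac{1+O(K^3\alpha)}{\sqrt{K+1}},$$ where $\eta$ is defined by $\max\{|\hat A(\chi)|:\chi\in\hat G\setminus\{1\}\}=\eta|A|$, and the implied constant in $O(\cdot)$ is absolute.
   Context: $\hat G$ is the dual group of characters of $G$, $1$ denotes the principal character, and $\hat A(\chi)=\sum_{a\in A}\chi(a)$ is the non-normalized Fourier coefficient of the indicator function of $A$. $A-A=\{a-b:a,b\in A\}$. *)

(* Defs.v *)
From HB Require Import structures.
From mathcomp Require Import all_boot all_order all_algebra.
From mathcomp Require Import all_fingroup all_solvable all_field all_character.

Set Implicit Arguments.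
Unset Strict Implicit.
Unset Printing Implicit Defensive.

Import Order.TTheory GRing.Theory Num.Theory.
Local Open Scope ring_scope.

(* The group law is written multiplicatively, so this is A - A. *)
Definition diffset (gT : finGroupType) (A : {set gT}) : {set gT} :=
  [set (a * b^-1)%g | a in A, b in A].

(* Linear characters take values in roots of unity, so [algC] serves
   as the field of complex numbers. *)
Definition fourier (gT : finGroupType) (G : {group gT}) (A : {set gT})
    (chi : 'CF(G)) : algC :=
  \sum_(a in A) chi a.

(* [m] is attained and is an upper bound. For abelian [G] the elements of the
   dual group are the linear characters of [G], and [1 : 'CF(G)] is the
   principal one. If [G] is trivial there is no such [m]: the maximum would be
   over the empty set. *)
Definition is_max_fourier (gT : finGroupType) (G : {group gT}) (A : {set gT})
    (m : algC) : Prop :=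
  (exists chi : 'CF(G),
     [/\ chi \is a linear_char, chi != 1 & `|fourier A chi| = m]) /\
  (forall chi : 'CF(G),
     chi \is a linear_char -> chi != 1 -> `|fourier A chi| <= m).

(* Main.v *)
Require Import Defs.
From HB Require Import structures.
From mathcomp Require Import all_boot all_order all_algebra.
From mathcomp Require Import all_fingroup all_solvable all_field all_character.
From mathcomp Require Import ring.

Set Implicit Arguments.
Unset Strict Implicit.
Unset Printing Implicit Defensive.

Import Order.TTheory GRing.Theory Num.Theory.
Local Open Scope ring_scope.

(** Write [D = A - A], [g = 1_D * 1_A] and [r = 1_(-A) * 1_A], additively.
    On [A] the function [g] equals [|A|]. Everywhere [g(x) >= r(x - a)] for all
    [a] in [A] with [x - a] in [D], so that [g(x)^2 >= \sum_(a in A) r(x - a)].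
    Using the first bound on [A] and the second one off [A] gives
    [\sum g^2 >= 2 |A|^3 - \sum r^2]. By Parseval,
    [\sum g^2 <= (K^2 alpha + eta^2 K) |A|^3] and
    [\sum r^2 <= (alpha + eta^2) |A|^3]; hence
    [eta^2 (K + 1) >= 2 - (K^2 + 1) alpha]. This is stronger than required:
    the golden ratio is at most 2, and the error term can be taken to be
    [- K^3 alpha]. *)

(** * Convolution of indicator functions as a representation count *)

Definition conv (gT : finGroupType) (A B : {set gT}) (x : gT) : nat :=
  (\sum_(a in A) \sum_(b in B) (a * b == x)%g)%N.

Section Convolution.
Local Open Scope nat_scope.
Variables (gT : finGroupType).
Implicit Types (A B : {set gT}) (G : {group gT}) (x : gT).

Lemma sum_eqb_mem (T : finType) (B : {set T}) (y : T) :
  \sum_(b in B) (b == y) = (y \in B).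
Proof.
case: (boolP (y \in B)) => yB.
  rewrite (bigD1 y) //= eqxx big1 // => b /andP[_ /negbTE->] //.
by rewrite big1 // => b bB; case: eqP => // bE; rewrite -bE bB in yB.
Qed.

Lemma convEr A B x : conv A B x = \sum_(b in B) (x * b^-1 \in A)%g.
Proof.
rewrite /conv exchange_big; apply: eq_bigr => b _; rewrite -sum_eqb_mem.
by apply: eq_bigr => a _; rewrite (can2_eq (mulgK b) (mulgKV b)).
Qed.

(** Pairs are grouped by their product. The general semiring serves both the counts in [nat] and the
    character sums in [algC]. *)
Lemma sum_conv_weight (R : pzSemiRingType) G A B (f : gT -> R) :
    A \subset G -> B \subset G ->
  (\sum_(x in G) (conv A B x)%:R * f x
    = \sum_(a in A) \sum_(b in B) f (a * b)%g)%R.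
Proof.
move=> sAG sBG.
transitivity (\sum_(x in G) \sum_(a in A) \sum_(b in B)
    (a * b == x)%g%:R * f x)%R.
  apply: eq_bigr => x _; rewrite /conv natr_sum mulr_suml.
  by apply: eq_bigr => a _; rewrite natr_sum mulr_suml.
rewrite exchange_big; apply: eq_bigr => a aA.
rewrite exchange_big; apply: eq_bigr => b bB.
have abG : (a * b)%g \in G by rewrite groupM ?(subsetP sAG a) ?(subsetP sBG b).
rewrite (bigD1 (a * b)%g) //= eqxx mul1r big1 ?addr0 // => x /andP[_].
by rewrite eq_sym => /negbTE->; rewrite mul0r.
Qed.

End Convolution.

(** * Combinatorial lower bound for the energies of [g] and [r] *)

Section Energy.
Local Open Scope nat_scope.
Variables (gT : finGroupType) (G : {group gT}) (A : {set gT}).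
Hypotheses (cGG : abelian G) (sAG : A \subset G).
Let D := diffset A.

Lemma diffset_sub : D \subset G.
Proof.
apply/subsetP => x /imset2P[a b aA bA ->].
by rewrite groupM ?groupV ?(subsetP sAG).
Qed.

Lemma mem_diffset a b : a \in A -> b \in A -> (a * b^-1)%g \in D.
Proof. by move=> aA bA; apply/imset2P; exists a b. Qed.

Lemma leq_card_diffset : A != set0 -> #|A| <= #|D|.
Proof.
case/set0Pn => b bA; rewrite -(card_rcoset A b^-1%g).
apply/subset_leq_card/subsetP => x /rcosetP[a aA ->].
exact: mem_diffset.
Qed.

Lemma conv_diffset_in x : x \in A -> conv D A x = #|A|.
Proof.
move=> xA; rewrite convEr -sum1_card; apply: eq_bigr => b bA.
by rewrite mem_diffset.
Qed.

Lemma convVE s : conv A^-1%g A s = \sum_(a in A) (a * s^-1 \in A)%g.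
Proof.
by rewrite convEr; apply: eq_bigr => a _; rewrite mem_invg invMg invgK.
Qed.

(** Any pair counted by [r] at [s] exhibits [s] as a quotient of two elements of [A]. *)
Lemma convV_notin_diffset s : s \in G -> s \notin D -> conv A^-1%g A s = 0.
Proof.
move=> sG; rewrite convVE => sD; apply: big1 => a aA.
case: (boolP (_ \in A)) => // bA; case/negP: sD.
have aG := subsetP sAG _ aA.
have -> : s = (a * (a * s^-1)^-1)%g.
  by rewrite invMg invgK (centsP cGG s sG a^-1%g) ?groupV // mulKVg.
exact: mem_diffset.
Qed.

(* The Katz-Koester inclusion: if [b] and [b - s] lie in [A], then
   [(a + s) - b = a - (b - s)] lies in [D]. *)
Lemma convV_le_conv_diffset a s : a \in A -> s \in G ->
  conv A^-1%g A s <= conv D A (s * a)%g.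
Proof.
move=> aA sG; rewrite convVE convEr; apply: leq_sum => b bA.
case: (boolP (_ \in A)) => // cA.
have [aG bG] := (subsetP sAG _ aA, subsetP sAG _ bA).
have -> : (s * a * b^-1 = a * (b * s^-1)^-1)%g.
  by rewrite invMg invgK mulgA (centsP cGG s sG a).
by rewrite mem_diffset.
Qed.

(** One factor [g(x)] counts the [a] with [x * a^-1] in [D]; for each of them the other factor is at
    least [r(x * a^-1)]. For the remaining [a] that value of [r] is 0. *)
Lemma conv_diffset_sqr_ge x : x \in G ->
  \sum_(a in A) conv A^-1%g A (x * a^-1)%g <= conv D A x ^ 2.
Proof.
move=> xG; rewrite expnS expn1 {1}convEr big_distrl /=.
apply: leq_sum => a aA.
have xaG : (x * a^-1)%g \in G by rewrite groupM ?groupV ?(subsetP sAG a).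
case: (boolP (_ \in D)) => [_|/convV_notin_diffset->//].
by have := convV_le_conv_diffset aA xaG; rewrite mulgKV mul1n.
Qed.

(** As [x] and [a] run over [A], the quotient [x * a^-1] takes each value [s] exactly [r(s)]
    times. *)
Lemma sum_convV_in :
  \sum_(x in A) \sum_(a in A) conv A^-1%g A (x * a^-1)%g
    = \sum_(s in G) conv A^-1%g A s ^ 2.
Proof.
have sVG : A^-1%g \subset G by rewrite -invSg invgK invGid.
have -> : \sum_(s in G) conv A^-1%g A s ^ 2
          = \sum_(b in A^-1%g) \sum_(a in A) conv A^-1%g A (b * a)%g.
  (* One factor [r(s)] is the multiplicity, the other the summed function. *)
  rewrite -[RHS](sum_conv_weight (conv A^-1%g A) sVG sAG).
  by apply: eq_bigr => s _; rewrite natn.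
rewrite exchange_big [RHS](reindex_inj invg_inj) /=.
apply: eq_big => [a|a aA]; first by rewrite mem_invg invgK.
apply: eq_bigr => x xA.
by rewrite (centsP cGG a^-1%g) ?groupV ?(subsetP sAG).
Qed.

(** For fixed [a] the sum over [x] is that of a translate of [r], of total mass [|A|^2]. *)
Lemma sum_convV_all :
  \sum_(x in G) \sum_(a in A) conv A^-1%g A (x * a^-1)%g = #|A| ^ 3.
Proof.
have sVG : A^-1%g \subset G by rewrite -invSg invgK invGid.
have sumr : \sum_(s in G) conv A^-1%g A s = #|A| ^ 2.
  transitivity (\sum_(b in A^-1%g) \sum_(a in A) 1).
    rewrite -[RHS](sum_conv_weight (fun _ => 1) sVG sAG).
    by apply: eq_bigr => s _; rewrite natn mulr1.
  by rewrite !sum_nat_const card_invg muln1.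
rewrite exchange_big expnS -sumr -sum_nat_const; apply: eq_bigr => a aA.
rewrite (reindex_inj (mulIg a)) /=; apply: eq_big => [s|s _].
  by rewrite groupMr ?(subsetP sAG a).
by rewrite mulgK.
Qed.

(** Split [G] along [A]. Inside, [g^2] sums to [|A|^3]. Outside, its sum is at least the total mass
    [|A|^3] of the translates of [r] minus their mass inside [A], which is the energy of [r]. *)
Lemma energy_ge :
  2 * #|A| ^ 3 <= \sum_(x in G) conv D A x ^ 2
                  + \sum_(s in G) conv A^-1%g A s ^ 2.
Proof.
rewrite -sum_convV_in mul2n -addnn -{1}sum_convV_all.
have split f : \sum_(x in G) f x
    = \sum_(x in A) f x + \sum_(x in G :\: A) f x.
  by rewrite (big_setID A) (setIidPr sAG).
rewrite 2!split.
have -> : \sum_(x in A) conv D A x ^ 2 = #|A| ^ 3.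
  rewrite expnS -sum_nat_const; apply: eq_bigr => x xA.
  by rewrite conv_diffset_in.
rewrite -addnA [leqRHS]addnC leq_add2l [leqLHS]addnC leq_add2l.
apply: leq_sum => x /setDP[xG _].
exact: conv_diffset_sqr_ge.
Qed.

End Energy.

(** * Parseval and Fourier bounds for convolutions *)

Section Fourier.
Variables (gT : finGroupType) (G : {group gT}).
Hypothesis cGG : abelian G.

(** Expand the squared modulus and sum over characters first: by column orthogonality only the
    diagonal survives, as conjugacy classes are singletons. *)
Lemma parseval_abelian (f : gT -> algC) :
  \sum_i `|\sum_(x in G) f x * 'chi[G]_i x| ^+ 2
    = #|G|%:R * \sum_(x in G) `|f x| ^+ 2.
Proof.
under eq_bigr => i _ do rewrite normCK rmorph_sum mulr_suml.
rewrite exchange_big mulr_sumr; apply: eq_bigr => x xG.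
under eq_bigr => i _ do rewrite mulr_sumr.
rewrite exchange_big (bigD1 x) //= [X in _ + X]big1 ?addr0.
  under eq_bigr => i _ do rewrite rmorphM mulrACA.
  rewrite -mulr_sumr -normCK second_orthogonality_relation //.
  (* The centraliser of [x] is all of [G], whence the factor [#|G|]. *)
  have /(_ x xG) := subsetP cGG; rewrite -sub_cent1 => /setIidPl->.
  by rewrite class_refl mulr1n mulrC.
move=> y /andP[yG nyx].
under eq_bigr => i _ do rewrite rmorphM mulrACA.
rewrite -mulr_sumr second_orthogonality_relation //.
suff /negbTE-> : x \notin (y ^: G)%g by rewrite mulr0n mulr0.
apply: contra nyx => /imsetP[z zG ->].
by rewrite conjgE (centsP cGG y yG z zG) mulKg.
Qed.

Lemma fourierE (A : {set gT}) (chi : 'CF(G)) : A \subset G ->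
  fourier A chi = \sum_(x in G) (x \in A)%:R * chi x.
Proof.
move=> sAG; rewrite (big_setID A) /= (setIidPr sAG).
rewrite [X in _ + X]big1 ?addr0; last first.
  by move=> x /setDP[_ /negbTE->]; rewrite mul0r.
by apply: eq_bigr => x ->; rewrite mul1r.
Qed.

Lemma parseval_set (A : {set gT}) : A \subset G ->
  \sum_i `|fourier A 'chi[G]_i| ^+ 2 = #|G|%:R * #|A|%:R.
Proof.
move=> sAG; under eq_bigr => i _ do rewrite fourierE //.
rewrite parseval_abelian; congr (_ * _).
rewrite (big_setID A) /= (setIidPr sAG) [X in _ + X]big1 ?addr0.
  rewrite -sum1_card natr_sum; apply: eq_bigr => x ->.
  by rewrite normr1 expr1n.
by move=> x /setDP[_ /negbTE->]; rewrite normr0 expr0n.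
Qed.

Lemma fourier_conv (A B : {set gT}) (chi : 'CF(G)) :
    chi \is a linear_char -> A \subset G -> B \subset G ->
  \sum_(x in G) (conv A B x)%:R * chi x = fourier A chi * fourier B chi.
Proof.
move=> lin sAG sBG; rewrite sum_conv_weight // mulr_suml.
apply: eq_bigr => a aA; rewrite mulr_sumr; apply: eq_bigr => b bB.
by rewrite lin_charM ?(subsetP sAG a) ?(subsetP sBG b).
Qed.

(** Parseval for the convolution: the principal character gives the first term; at the others the
    transform of [A] is at most [M], and Parseval for [B] bounds what is left. *)
Lemma sum_conv_sqr_le (A B : {set gT}) (M : algC) :
    A \subset G -> B \subset G -> 0 <= M ->
    (forall chi : 'CF(G), chi \is a linear_char -> chi != 1 ->
       `|fourier A chi| <= M) ->
  #|G|%:R * \sum_(x in G) (conv B A x)%:R ^+ 2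
    <= (#|B|%:R * #|A|%:R) ^+ 2 + M ^+ 2 * (#|G|%:R * #|B|%:R).
Proof.
move=> sAG sBG M0 leM.
have lin i : 'chi[G]_i \is a linear_char by apply: char_abelianP.
have -> : \sum_(x in G) (conv B A x)%:R ^+ 2
          = \sum_(x in G) `|(conv B A x)%:R : algC| ^+ 2.
  by apply: eq_bigr => x _; rewrite normr_nat.
rewrite -parseval_abelian (bigD1 0) //=.
have f1 (S : {set gT}) : S \subset G -> fourier S 'chi[G]_0 = #|S|%:R.
  move=> sSG; rewrite -sum1_card natr_sum; apply: eq_bigr => x xS.
  by rewrite irr0 cfun1E (subsetP sSG).
rewrite fourier_conv // !f1 // normrM !normr_nat lerD2l.
rewrite -(parseval_set sBG) mulr_sumr [leRHS](bigD1 0) //=.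
(* The principal term of [B] is nonnegative and is dropped. *)
apply: ler_wpDl; first by rewrite mulr_ge0 ?exprn_ge0.
apply: ler_sum => i i0; rewrite fourier_conv // normrM exprMn mulrC.
by rewrite ler_wpM2r ?exprn_ge0 // lerXn2r ?nnegrE // leM ?irr_eq1.
Qed.

End Fourier.

(** * Numerical bounds and the estimate for [eta] *)

Lemma golden_ratio_bounds : 0 <= ((1 + sqrtC 5) / 2 : algC) <= 2.
Proof.
have s0 : 0 <= sqrtC 5 :> algC by rewrite sqrtC_ge0.
have s3 : sqrtC 5 <= 3 :> algC.
  by rewrite -(@ler_pXn2r _ 2) ?nnegrE // sqrtCK -natrX ler_nat.
rewrite divr_ge0 ?addr_ge0 // ler_pdivrMr ?ltr0n // -natrM.
by apply: le_trans (lerD (lexx 1) s3) _; rewrite nat1r.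
Qed.

Section MaxFourier.
Variables (gT : finGroupType) (G : {group gT}) (A : {set gT}).
Variables (alpha K eta : algC).
Hypotheses (cGG : abelian G) (sAG : A \subset G) (nzA : A != set0).
Hypothesis alphaE : alpha = #|A|%:R / #|G|%:R.
Hypothesis KE : #|diffset A|%:R = K * #|A|%:R.
Hypothesis etaP : is_max_fourier G A (eta * #|A|%:R).

Let A_gt0 : 0 < #|A|%:R :> algC.
Proof. by rewrite ltr0n card_gt0. Qed.

Let G_gt0 : 0 < #|G|%:R :> algC.
Proof. by rewrite ltr0n cardG_gt0. Qed.

Lemma max_fourier_ge0 : 0 <= eta.
Proof.
case: etaP => [[chi [_ _ chiE]] _].
by rewrite -(pmulr_lge0 _ A_gt0) -chiE.
Qed.

Lemma doubling_ge1 : 1 <= K.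
Proof.
by rewrite -(ler_pM2r A_gt0) mul1r -KE ler_nat leq_card_diffset.
Qed.

Lemma density_ge0 : 0 <= alpha.
Proof. by rewrite alphaE divr_ge0. Qed.

(** The Fourier upper bounds for [B = D] and [B = A^-1] are added, compared with [energy_ge], and
    divided by [|G| |A|^3]. *)
Lemma max_fourier_sqr_ge : 2 - (K ^+ 2 + 1) * alpha <= eta ^+ 2 * (K + 1).
Proof.
have eta0 := max_fourier_ge0.
have M0 : 0 <= eta * #|A|%:R by rewrite mulr_ge0.
have sVG : A^-1%g \subset G by rewrite -invSg invgK invGid.
have [_ leM] := etaP.
have leD := sum_conv_sqr_le cGG sAG (diffset_sub sAG) M0 leM.
have leV := sum_conv_sqr_le cGG sAG sVG M0 leM.
have := energy_ge cGG sAG.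
rewrite -(ler_nat algC) natrD natrM natrX !natr_sum => leE.
have {}leE : #|G|%:R * (2 * #|A|%:R ^+ 3) <=
    (#|diffset A|%:R * #|A|%:R) ^+ 2
      + (eta * #|A|%:R) ^+ 2 * (#|G|%:R * #|diffset A|%:R)
    + ((#|A^-1%g|%:R * #|A|%:R) ^+ 2
      + (eta * #|A|%:R) ^+ 2 * (#|G|%:R * #|A^-1%g|%:R)) :> algC.
  apply: le_trans (lerD leD leV); rewrite -mulrDr ler_pM2l //.
  by apply: le_trans leE _; under eq_bigr do rewrite natrX;
     under [X in _ + X <= _]eq_bigr do rewrite natrX.
move: leE; rewrite card_invg KE.
have AE : #|A|%:R = alpha * #|G|%:R by rewrite alphaE divfK ?gt_eqF.
have GA3 : 0 < #|G|%:R * #|A|%:R ^+ 3 :> algC by rewrite mulr_gt0 ?exprn_gt0.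
move=> leE; rewrite lerBlDr -(ler_pM2r GA3).
set N := #|G|%:R in AE leE GA3 *; set a := #|A|%:R in AE leE GA3 *.
have -> : 2 * (N * a ^+ 3) = N * (2 * a ^+ 3) by rewrite mulrCA.
apply: le_trans leE _; rewrite le_eqVlt; apply/orP; left; apply/eqP.
rewrite mulrDl [(_ + 1) * alpha * _]mulrA.
(* Since [alpha * N = a], the density term is the contribution of the principal character. *)
have -> : (K ^+ 2 + 1) * alpha * N * a ^+ 3 = (K ^+ 2 + 1) * a ^+ 4.
  by rewrite -[_ * alpha * N]mulrA -AE -mulrA -exprS.
ring.
Qed.

End MaxFourier.

Theorem theorem6 :
  exists2 C : algC, 0 <= C &
    forall (gT : finGroupType) (G : {group gT}) (A : {set gT})
           (alpha K eta : algC),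
      abelian G -> A \subset G -> A != set0 ->
      alpha = #|A|%:R / #|G|%:R ->
      #|diffset A|%:R = K * #|A|%:R ->
      is_max_fourier G A (eta * #|A|%:R) ->
      exists err : algC,
        [/\ err \is Num.real,
            `|err| <= C * (K ^+ 3 * alpha) &
            sqrtC ((1 + sqrtC 5) / 2) * ((1 + err) / sqrtC (K + 1)) <= eta].
Proof.
exists 1 => // gT G A alpha K eta cGG sAG nzA alphaE KE etaP.
have eta0 := max_fourier_ge0 nzA etaP.
have K1 := doubling_ge1 nzA KE.
have alpha0 := density_ge0 alphaE.
have leEta := max_fourier_sqr_ge cGG sAG nzA alphaE KE etaP.
have /andP[phi0 phi2] := golden_ratio_bounds.
have K0 : 0 <= K by apply: le_trans K1.
have Kp : 0 < K + 1 by rewrite ltr_wpDl.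
set beta := K ^+ 3 * alpha.
have beta0 : 0 <= beta by rewrite mulr_ge0 ?exprn_ge0.
exists (- beta); rewrite realN ger0_real // normrN ger0_norm // mul1r lexx.
split=> //; rewrite mulrA ler_pdivrMr ?sqrtC_gt0 //.
have rhs0 : 0 <= eta * sqrtC (K + 1) by rewrite mulr_ge0 ?sqrtC_ge0 ?(ltW Kp).
have real1b : 1 - beta \is Num.real by rewrite rpredB ?real1 ?ger0_real.
(* If [1 - beta <= 0], the left side is nonpositive; otherwise both sides may be squared. *)
have [le0|gt0] := real_leP real1b (real0 _).
  by apply: le_trans rhs0; rewrite mulr_ge0_le0 ?sqrtC_ge0.
have lhs0 : 0 <= sqrtC ((1 + sqrtC 5) / 2) * (1 - beta).
  by rewrite mulr_ge0 ?sqrtC_ge0 // ltW.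
rewrite -(@ler_pXn2r _ 2) ?nnegrE //.
rewrite !exprMn !sqrtCK; apply: le_trans leEta.
have le1 : 1 - beta <= 1 by rewrite gerBl.
(* As [0 < 1 - beta <= 1], squaring only decreases it, so a bound linear in [beta] suffices. *)
have sq : (1 - beta) ^+ 2 <= 1 - beta by rewrite expr2 ler_piMl ?(ltW gt0).
apply: (@le_trans _ _ (2 * (1 - beta))).
  by apply: ler_pM => //; rewrite exprn_ge0 ?(ltW gt0).
(* What remains is [K^2 + 1 <= 2 K^3], which holds as [K >= 1]. *)
rewrite mulrBr mulr1 lerD2l lerN2 /beta mulrA ler_wpM2r // mulr_natl mulr2n.
by rewrite lerD ?exprn_ege1 // ler_weXn2l.
Qed.
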